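(* Let $\alpha$ be an infinite cardinal and $I=\{X: X\subseteq\alpha,\ X\text{ finite}\}$. There exists an $\alpha$-regular ultrafilter $U$ on $I$ such that every MV-algebra $\mathbf M=(M;\oplus,\neg,0)$ with $|M|\leq\alpha$ satisfies: (1) $\mathbf M$ embeds into the MV-algebra $\left((\prod_{X\in I}\mathbb Q\cap[0,1])/U\right)^{2^{\alpha}}$ of all functions from $2^{\alpha}$ (the set of subsets of $\alpha$) to the ultrapower $(\prod_{X\in I}\mathbb Q\cap[0,1])/U$, with pointwise operations; (2) $\mathbf M$ embeds into the MV-algebra $\left((\prod_{X\in I}[0,1])/U\right)^{2^{\alpha}}$ of all functions from $2^{\alpha}$ to the ultrapower $(\prod_{X\in I}[0,1])/U$, with pointwise operations.
   Context: An MV-algebra is an algebra $(A,\oplus,\neg,0)$ of type $(2,1,0)$ such that $\oplus$ is commutative and associative, $x\oplus 0=x$, $\neg\neg x=x$, $x\oplus 1=1$ where $1:=\neg 0$, and $\neg(\neg x\oplus y)\oplus y=\neg(\neg y\oplus x)\oplus x$. $[0,1]$ is the standard MV-algebra on the real unit interval with $x\oplus y=\min\{x+y,1\}$, $\neg x=1-x$, and $\mathbb Q\cap[0,1]$ is its subalgebra on the rationals. A proper filter $D$ on $I$ is $\alpha$-regular if there is $E\subseteq D$ with $|E|=\alpha$ such that each $i\in I$ belongs to only finitely many members of $E$. For algebras $\mathbf A_X$ and an ultrafilter $U$ on $I$, $(\prod_{X\in I}\mathbf A_X)/U$ is the quotient of the product by the congruence identifying $x,y$ iff $\{X: x(X)=y(X)\}\in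 U$.
   Formalization: The MV-algebra M is assumed nontrivial (0 ≠ 1), since the one-element MV-algebra satisfies |M| ≤ α but cannot embed into a power of the ultrapower, where 0 ≠ 1. *)

(* Defs.v *)
From HB Require Import structures.
From mathcomp Require Import all_boot all_order all_algebra generic_quotient.
From mathcomp Require Import boolp classical_sets cardinality filter reals.
From mathcomp Require Import lra.

Set Implicit Arguments.
Unset Strict Implicit.
Unset Printing Implicit Defensive.

Import Order.TTheory GRing.Theory Num.Theory.
Local Open Scope classical_set_scope.
Local Open Scope ring_scope.
Local Open Scope quotient_scope.
Local Open Scope card_scope.

HB.mixin Record isMVAlgebra A := {
  mv_add : A -> A -> A;
  mv_neg : A -> A;
  mv_zero : A;
  mv_addC : commutative mv_add;
  mv_addA : associative mv_add;
  mv_addx0 : right_id mv_zero mv_add;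
  mv_negK : involutive mv_neg;
  mv_addx1 : forall x, mv_add x (mv_neg mv_zero) = mv_neg mv_zero;
  mv_lukasiewicz : forall x y,
    mv_add (mv_neg (mv_add (mv_neg x) y)) y =
    mv_add (mv_neg (mv_add (mv_neg y) x)) x }.

#[short(type="mvAlgType")]
HB.structure Definition MVAlgebra := { A of isMVAlgebra A }.

Definition mv_one {A : mvAlgType} : A := mv_neg mv_zero.

Definition mv_embedding (A B : mvAlgType) (f : A -> B) : Prop :=
  [/\ {morph f : x y / mv_add x y},
      {morph f : x / mv_neg x},
      f mv_zero = mv_zero
    & injective f].

Definition mv_embeds (A B : mvAlgType) : Prop :=
  exists f : A -> B, mv_embedding f.

Section ProductAlgebra.
Variables (I : Type) (A : I -> mvAlgType).
Implicit Types x y z : forall i, A i.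

Definition prod_add x y : forall i, A i := fun i => mv_add (x i) (y i).
Definition prod_neg x : forall i, A i := fun i => mv_neg (x i).
Definition prod_zero : forall i, A i := fun=> mv_zero.

Fact prod_addC : commutative prod_add.
Proof. by move=> x y; apply: functional_extensionality_dep => i; exact: mv_addC. Qed.

Fact prod_addA : associative prod_add.
Proof. by move=> x y z; apply: functional_extensionality_dep => i; exact: mv_addA. Qed.

Fact prod_addx0 : right_id prod_zero prod_add.
Proof. by move=> x; apply: functional_extensionality_dep => i; exact: mv_addx0. Qed.

Fact prod_negK : involutive prod_neg.
Proof. by move=> x; apply: functional_extensionality_dep => i; exact: mv_negK. Qed.

Fact prod_addx1 x : prod_add x (prod_neg prod_zero) = prod_neg prod_zero.
Proof. by apply: functional_extensionality_dep => i; exact: mv_addx1. Qed.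

Fact prod_lukasiewicz x y :
  prod_add (prod_neg (prod_add (prod_neg x) y)) y =
  prod_add (prod_neg (prod_add (prod_neg y) x)) x.
Proof. by apply: functional_extensionality_dep => i; exact: mv_lukasiewicz. Qed.

HB.instance Definition _ := isMVAlgebra.Build (forall i, A i)
  prod_addC prod_addA prod_addx0 prod_negK prod_addx1 prod_lukasiewicz.

End ProductAlgebra.

Section Ultraproduct.
Variables (I : Type) (U : set_system I) (UU : UltraFilter U).
Variable A : I -> mvAlgType.
Implicit Types x y z : forall i, A i.

(* Quotient types need a choice structure on the base type, whence [{classic _}],
   an alias of its argument. *)
Definition ultra_eq : rel {classic forall i, A i} :=
  fun x y => `[< U [set i | x i = y i] >].

Fact ultra_eq_refl : reflexive ultra_eq.
Proof. by move=> x; apply/asboolP; apply: filterS filterT => i. Qed.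

Fact ultra_eq_sym : symmetric ultra_eq.
Proof.
by move=> x y; apply/asboolP/asboolP; apply: filterS => i /= ->.
Qed.

Fact ultra_eq_trans : transitive ultra_eq.
Proof.
move=> y x z /asboolP xy /asboolP yz; apply/asboolP.
by apply: filterS (filterI xy yz) => i /= [-> ->].
Qed.

Canonical ultra_equiv :=
  EquivRel ultra_eq ultra_eq_refl ultra_eq_sym ultra_eq_trans.

Definition ultraproduct : Type := {eq_quot ultra_equiv}.

Definition ultra_class x : ultraproduct := \pi_({eq_quot ultra_equiv}) x.

Lemma ultra_classP x y :
  ultra_class x = ultra_class y <-> U [set i | x i = y i].
Proof. by split=> [/eqmodP/asboolP//|xy]; apply/eqmodP/asboolP. Qed.

Definition ultra_repr (u : ultraproduct) : forall i, A i :=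
  repr (u : {eq_quot ultra_equiv}).

Lemma ultra_reprK : cancel ultra_repr ultra_class.
Proof. by move=> u; rewrite /ultra_class /ultra_repr reprK. Qed.

Definition ultra_add (u v : ultraproduct) : ultraproduct :=
  ultra_class (mv_add (ultra_repr u) (ultra_repr v)).
Definition ultra_neg (u : ultraproduct) : ultraproduct :=
  ultra_class (mv_neg (ultra_repr u)).
Definition ultra_zero : ultraproduct := ultra_class mv_zero.

Lemma ultra_reprE x : U [set i | ultra_repr (ultra_class x) i = x i].
Proof. by apply/ultra_classP; rewrite ultra_reprK. Qed.

Lemma ultra_class_add x y :
  ultra_class (mv_add x y) = ultra_add (ultra_class x) (ultra_class y).
Proof.
apply/esym/ultra_classP.
by apply: filterS (filterI (ultra_reprE x) (ultra_reprE y)) => i /= [xE yE];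
  rewrite /mv_add/= /prod_add xE yE.
Qed.

Lemma ultra_class_neg x : ultra_class (mv_neg x) = ultra_neg (ultra_class x).
Proof.
apply/esym/ultra_classP.
by apply: filterS (ultra_reprE x) => i /= xE; rewrite /mv_neg/= /prod_neg xE.
Qed.

Fact ultra_addC : commutative ultra_add.
Proof. by move=> u v; rewrite /ultra_add mv_addC. Qed.

Fact ultra_addA : associative ultra_add.
Proof.
move=> u v w; rewrite -(ultra_reprK u) -(ultra_reprK v) -(ultra_reprK w).
by rewrite -!ultra_class_add mv_addA.
Qed.

Fact ultra_addx0 : right_id ultra_zero ultra_add.
Proof.
by move=> u; rewrite -(ultra_reprK u) -ultra_class_add mv_addx0.
Qed.

Fact ultra_negK : involutive ultra_neg.
Proof. by move=> u; rewrite -(ultra_reprK u) -!ultra_class_neg mv_negK. Qed.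

Fact ultra_addx1 u : ultra_add u (ultra_neg ultra_zero) = ultra_neg ultra_zero.
Proof.
by rewrite -(ultra_reprK u) -ultra_class_neg -ultra_class_add mv_addx1.
Qed.

Fact ultra_lukasiewicz u v :
  ultra_add (ultra_neg (ultra_add (ultra_neg u) v)) v =
  ultra_add (ultra_neg (ultra_add (ultra_neg v) u)) u.
Proof.
rewrite -(ultra_reprK u) -(ultra_reprK v).
by rewrite -!(ultra_class_neg, ultra_class_add) mv_lukasiewicz.
Qed.

HB.instance Definition _ := isMVAlgebra.Build ultraproduct
  ultra_addC ultra_addA ultra_addx0 ultra_negK ultra_addx1 ultra_lukasiewicz.

End Ultraproduct.

Definition unit_interval (F : realFieldType) : Type := {x : F | 0 <= x <= 1}.

Section UnitInterval.
Variable F : realFieldType.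
Local Notation I01 := (unit_interval F).
Implicit Types x y z : I01.

Fact unit_add_subproof x y : 0 <= Num.min (sval x + sval y) 1 <= 1.
Proof.
case: x y => [x /= /andP[? ?]] [y /= /andP[? ?]].
by rewrite ge_min lexx orbT andbT le_min ler01 addr_ge0.
Qed.

Definition unit_add x y : I01 :=
  exist (fun t : F => 0 <= t <= 1) _ (unit_add_subproof x y).

Fact unit_neg_subproof x : 0 <= 1 - sval x <= 1.
Proof. by case: x => x /= /andP[? ?]; apply/andP; split; lra. Qed.

Definition unit_neg x : I01 :=
  exist (fun t : F => 0 <= t <= 1) _ (unit_neg_subproof x).

Definition unit_zero : I01 :=
  exist (fun t : F => 0 <= t <= 1) 0 (introT andP (conj (lexx 0) ler01)).

Fact unit_addC : commutative unit_add.
Proof. by move=> x y; apply: val_inj; rewrite /= addrC. Qed.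

Fact unit_addA : associative unit_add.
Proof.
move=> x y z; apply: val_inj => /=.
case: x y z => [x xP] [y yP] [z zP] /=.
move: xP yP zP => /andP[? ?] /andP[? ?] /andP[? ?]; rewrite !minEle.
case: (leP (y + z) 1) => ?; case: (leP (x + y) 1) => ?.
all: by do ![case: leP => ?]; lra.
Qed.

Fact unit_addx0 : right_id unit_zero unit_add.
Proof.
move=> x; apply: val_inj => /=; case: x => x /= /andP[? ?].
by rewrite addr0; apply/min_idPl.
Qed.

Fact unit_negK : involutive unit_neg.
Proof. by move=> x; apply: val_inj => /=; rewrite opprB addrC subrK. Qed.

Fact unit_addx1 x : unit_add x (unit_neg unit_zero) = unit_neg unit_zero.
Proof.
apply: val_inj => /=; case: x => x /= /andP[? ?].
by rewrite subr0; apply/min_idPr; rewrite lerDr.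
Qed.

Fact unit_lukasiewicz x y :
  unit_add (unit_neg (unit_add (unit_neg x) y)) y =
  unit_add (unit_neg (unit_add (unit_neg y) x)) x.
Proof.
apply: val_inj => /=; case: x y => [x xP] [y yP] /=.
move: xP yP => /andP[? ?] /andP[? ?].
rewrite !minEle; case: (leP (1 - x + y) 1) => ?.
all: case: (leP (1 - y + x) 1) => ?.
all: by do ![case: leP => ?]; lra.
Qed.

HB.instance Definition _ := isMVAlgebra.Build (unit_interval F)
  unit_addC unit_addA unit_addx0 unit_negK unit_addx1 unit_lukasiewicz.

End UnitInterval.

(* [unit_interval rat] is isomorphic, via [ratr], to the subalgebra of
   [unit_interval R] on the rational points. *)
Lemma unit_interval_rat (R : realType) :
  exists f : unit_interval rat -> unit_interval R,
    [/\ mv_embedding f, forall x, sval (f x) = ratr (sval x)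
      & range f = [set y | exists q : rat, sval y = ratr q]].
Proof.
have P (x : unit_interval rat) : 0 <= (ratr (sval x) : R) <= 1.
  case: x => x /= /andP[x0 x1].
  by rewrite ler0q x0 /= -(rmorph1 (@ratr R)) ler_rat.
exists (fun x => exist (fun t : R => 0 <= t <= 1) _ (P x)); split=> //.
- split.
  + move=> x y; apply: val_inj => /=.
    rewrite -rmorphD/= !minEle -[X in _ <= X :> R](rmorph1 (@ratr R)) ler_rat.
    by case: ifP => _; rewrite ?rmorph1.
  + by move=> x; apply: val_inj; rewrite /= rmorphB rmorph1.
  + by apply: val_inj; rewrite /= rmorph0.
  + by move=> x y /(congr1 sval)/= /fmorph_inj xy; apply: val_inj.
- apply/seteqP; split=> [_ [x _ <-]|y [q yq]]; first by exists (sval x).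
  have qP : 0 <= q <= 1.
    have := svalP y; rewrite yq ler0q -[X in _ <= X :> R](rmorph1 (@ratr R)).
    by rewrite ler_rat.
  by exists (exist (fun t : rat => 0 <= t <= 1) q qP) => //; apply: val_inj.
Qed.

Definition finite_subset (T : Type) : Type := {X : set T | finite_set X}.

(* A cardinal alpha is represented by a type of that cardinality. *)
Definition regular_filter (alpha I : Type) (D : set_system I) : Prop :=
  ProperFilter D /\
  exists E : set (set I), [/\ E `<=` D, E #= [set: alpha]
    & forall i : I, finite_set [set e | E e /\ e i]].

(* Main.v *)
(** An ideal of [M] maximal among those omitting a nonzero element [a] is prime,
    so [a] survives in a quotient [C] of [M] that is a chain.  Addition with carry
    on [nat * C] is the positive part of Chang's totally ordered group of [C].
    Fourier-Motzkin elimination turns any finite set of weak linear inequalities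
    holding in that group, where [a > 0], into a solution over an arbitrary ordered
    field with [a = 1]; after division by the value of the unit this is a partial
    homomorphism into the unit interval, defined on any prescribed finite subset of
    [M] and nonzero at [a].  An ultrafilter on the finite subsets of alpha that
    contains every [{X | x \in X}] is alpha-regular, and along it these partial
    homomorphisms glue to a homomorphism of [M] into the ultrapower that is nonzero
    at [a].  Letting [a] vary separates the points of [M]. *)

From HB Require Import structures.
Require Import Defs.
From mathcomp Require Import all_boot all_order all_algebra generic_quotient.
From mathcomp Require Import boolp classical_sets functions cardinality filter reals.
From mathcomp Require Import zify ring lra.

Set Implicit Arguments.
Unset Strict Implicit.
Unset Printing Implicit Defensive.

Import Order.TTheory GRing.Theory Num.Theory.
Local Open Scope classical_set_scope.
Local Open Scope card_scope.
Local Open Scope quotient_scope.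

Declare Scope mv_scope.
Delimit Scope mv_scope with mv.
Local Open Scope mv_scope.

Notation "x ⊕ y" := (mv_add x y) (at level 50, left associativity) : mv_scope.
Notation "¬ x" := (mv_neg x) (at level 35, right associativity) : mv_scope.

(** In the unit interval [mv_sub], [mv_mul] and [mv_meet] are [max(x - y, 0)], [max(x + y - 1, 0)]
    and the minimum; [x ≤ₘ ¬ y] says there that [x + y] is not truncated. *)
Definition mv_sub {A : mvAlgType} (x y : A) : A := ¬ (¬ x ⊕ y).
Definition mv_mul {A : mvAlgType} (x y : A) : A := ¬ (¬ x ⊕ ¬ y).
Definition mv_meet {A : mvAlgType} (x y : A) : A := mv_sub x (mv_sub x y).
Definition mv_le {A : mvAlgType} (x y : A) : Prop := ¬ x ⊕ y = mv_one.
Definition mv_chain (A : mvAlgType) : Prop := forall x y : A, mv_le x y \/ mv_le y x.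

Notation "x ⊖ y" := (mv_sub x y) (at level 50, left associativity) : mv_scope.
Notation "x ⊙ y" := (mv_mul x y) (at level 40, left associativity) : mv_scope.
Notation "x ∧ₘ y" := (mv_meet x y) (at level 40, left associativity) : mv_scope.
Notation "x ≤ₘ y" := (mv_le x y) (at level 70) : mv_scope.

(** * The order of an MV-algebra *)

Section MVOrder.
Variable A : mvAlgType.
Implicit Types x y z t w : A.
Local Notation "0" := (mv_zero : A) : mv_scope.
Local Notation "1" := (mv_one : A) : mv_scope.

Lemma mv_add0x x : 0 ⊕ x = x.
Proof. by rewrite mv_addC mv_addx0. Qed.

Lemma mv_add1x x : 1 ⊕ x = 1.
Proof. by rewrite mv_addC mv_addx1. Qed.

Lemma mv_addAC x y z : x ⊕ y ⊕ z = x ⊕ z ⊕ y.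
Proof. by rewrite -!mv_addA (mv_addC y). Qed.

Lemma mv_addCA x y z : x ⊕ (y ⊕ z) = y ⊕ (x ⊕ z).
Proof. by rewrite !mv_addA (mv_addC x). Qed.

Lemma mv_neg1 : ¬ 1 = 0.
Proof. exact: mv_negK. Qed.

Lemma mv_neg_inj x y : ¬ x = ¬ y -> x = y.
Proof. exact: (can_inj mv_negK). Qed.

Lemma mv_addNx x : ¬ x ⊕ x = 1.
Proof.
by have := mv_lukasiewicz x 1; rewrite mv_addx1 mv_neg1 mv_add0x.
Qed.

Lemma mv_addxN x : x ⊕ ¬ x = 1.
Proof. by rewrite mv_addC mv_addNx. Qed.

Lemma mv_le_refl x : x ≤ₘ x.
Proof. exact: mv_addNx. Qed.
Hint Resolve mv_le_refl : core.

(** By the Łukasiewicz axiom the left side is [x ⊖ y ⊕ y], and [x ⊖ y] vanishes. Monotonicity and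
    transitivity come from writing [y] as a sum in this way. *)
Lemma mv_subK x y : x ≤ₘ y -> y ⊖ x ⊕ x = y.
Proof.
by move=> xy; rewrite /mv_sub -mv_lukasiewicz xy mv_neg1 mv_add0x.
Qed.

Lemma mv_le_addr x y : x ≤ₘ x ⊕ y.
Proof. by rewrite /mv_le mv_addA mv_addNx mv_add1x. Qed.

Lemma mv_le_addl x y : x ≤ₘ y ⊕ x.
Proof. by rewrite mv_addC; exact: mv_le_addr. Qed.

Lemma mv_le_trans y x z : x ≤ₘ y -> y ≤ₘ z -> x ≤ₘ z.
Proof.
move=> /mv_subK <- /mv_subK <-; rewrite mv_addA; exact: mv_le_addl.
Qed.

Lemma mv_le_anti x y : x ≤ₘ y -> y ≤ₘ x -> x = y.
Proof.
by move=> /mv_subK xy yx; rewrite -xy /mv_sub yx mv_neg1 mv_add0x.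
Qed.

Lemma mv_le0x x : 0 ≤ₘ x.
Proof. exact: mv_add1x. Qed.

Lemma mv_lex1 x : x ≤ₘ 1.
Proof. exact: mv_addx1. Qed.
Hint Resolve mv_le0x mv_lex1 : core.

Lemma mv_lex0 x : x ≤ₘ 0 -> x = 0.
Proof. by move=> /mv_le_anti; apply. Qed.

Lemma mv_le1x x : 1 ≤ₘ x -> x = 1.
Proof. by move=> h; apply/mv_le_anti. Qed.

Lemma mv_le_add2r z x y : x ≤ₘ y -> x ⊕ z ≤ₘ y ⊕ z.
Proof. by move=> /mv_subK <-; rewrite -mv_addA; exact: mv_le_addl. Qed.

Lemma mv_le_add x y z t : x ≤ₘ y -> z ≤ₘ t -> x ⊕ z ≤ₘ y ⊕ t.
Proof.
move=> /(mv_le_add2r z) xy /(mv_le_add2r y) zt.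
by apply: mv_le_trans xy _; rewrite mv_addC (mv_addC y).
Qed.

Lemma mv_le_neg x y : x ≤ₘ y -> ¬ y ≤ₘ ¬ x.
Proof. by rewrite /mv_le mv_negK mv_addC. Qed.

Lemma mv_leN x y : x ≤ₘ ¬ y -> y ≤ₘ ¬ x.
Proof. by rewrite /mv_le mv_addC. Qed.

Lemma mv_Nle x y : ¬ x ≤ₘ y <-> x ⊕ y = 1.
Proof. by rewrite /mv_le mv_negK. Qed.

Lemma mv_le_subl x y z : x ⊖ y ≤ₘ z <-> x ≤ₘ y ⊕ z.
Proof. by rewrite /mv_le /mv_sub mv_negK mv_addA. Qed.

Lemma mv_sub_le x y : x ⊖ y ≤ₘ x.
Proof. by apply/mv_le_subl; exact: mv_le_addl. Qed.

Lemma mv_sub_leN x y : x ⊖ y ≤ₘ ¬ y.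
Proof. by apply: mv_le_neg; exact: mv_le_addl. Qed.

Lemma mv_subxx x : x ⊖ x = 0.
Proof. by rewrite /mv_sub mv_addNx mv_neg1. Qed.

Lemma mv_sub_eq0 x y : x ⊖ y = 0 <-> x ≤ₘ y.
Proof.
split=> [xy|xy]; last by rewrite /mv_sub xy mv_neg1.
by rewrite /mv_le -[LHS]mv_negK -/(x ⊖ y) xy.
Qed.

Lemma mv_le_add_sub x y : x ≤ₘ y ⊕ (x ⊖ y).
Proof. exact/mv_le_subl. Qed.

Lemma mv_le_sub2r z x y : x ≤ₘ y -> x ⊖ z ≤ₘ y ⊖ z.
Proof. by move=> xy; apply: mv_le_neg; apply/mv_le_add2r/mv_le_neg. Qed.

Lemma mv_mulE x y : x ⊙ y = x ⊖ ¬ y.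
Proof. by []. Qed.

Lemma mv_mulC x y : x ⊙ y = y ⊙ x.
Proof. by rewrite /mv_mul mv_addC. Qed.

Lemma mv_mul_lel x y : x ⊙ y ≤ₘ x.
Proof. exact: mv_sub_le. Qed.

Lemma mv_mul_ler x y : x ⊙ y ≤ₘ y.
Proof. by rewrite mv_mulC; exact: mv_mul_lel. Qed.

Lemma mv_mul_eq0 x y : x ⊙ y = 0 <-> x ≤ₘ ¬ y.
Proof. exact: mv_sub_eq0. Qed.

Lemma mv_le_mul2r z x y : x ≤ₘ y -> x ⊙ z ≤ₘ y ⊙ z.
Proof. exact: mv_le_sub2r. Qed.

Lemma mv_add_mulK x y : ¬ y ≤ₘ x -> x ⊙ y ⊕ ¬ y = x.
Proof. exact: mv_subK. Qed.

Lemma mv_addK x y : x ≤ₘ ¬ y -> (x ⊕ y) ⊖ y = x.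
Proof.
move=> xy; have := mv_subK (mv_leN xy); rewrite /mv_sub mv_negK => h.
by apply: mv_neg_inj; rewrite mv_negK -[RHS]h (mv_addC x).
Qed.

Lemma mv_meetC x y : x ∧ₘ y = y ∧ₘ x.
Proof.
have := mv_lukasiewicz (¬ x) (¬ y); rewrite !mv_negK => h.
rewrite /mv_meet /mv_sub; congr mv_neg.
by rewrite mv_addC (mv_addC (¬ x) y) -h mv_addC (mv_addC x).
Qed.

Lemma mv_meet_lel x y : x ∧ₘ y ≤ₘ x.
Proof. exact: mv_sub_le. Qed.

Lemma mv_meet_ler x y : x ∧ₘ y ≤ₘ y.
Proof. by rewrite mv_meetC; exact: mv_meet_lel. Qed.

Lemma mv_le_sub2l z x y : x ≤ₘ y -> z ⊖ y ≤ₘ z ⊖ x.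
Proof.
move=> xy; apply/mv_le_subl; apply: mv_le_trans (mv_le_add_sub z x) _.
exact: mv_le_add2r.
Qed.

(** From [z ≤ₘ x] follows [z = x ⊖ (x ⊖ z)]; [z ≤ₘ y] then passes twice through the antitone second
    argument of [⊖]. *)
Lemma mv_le_meet z x y : z ≤ₘ x -> z ≤ₘ y -> z ≤ₘ x ∧ₘ y.
Proof.
move=> zx zy; suff {1}<- : x ⊖ (x ⊖ z) = z by do 2!apply: mv_le_sub2l.
rewrite -{1}(mv_subK zx) mv_addC mv_addK //; apply: mv_leN; exact: mv_sub_leN.
Qed.

Lemma mv_add_meetr x y z : x ⊕ (y ∧ₘ z) = (x ⊕ y) ∧ₘ (x ⊕ z).
Proof.
apply: mv_le_anti.
  by apply: mv_le_meet; apply: mv_le_add => //; [exact: mv_meet_lel|exact: mv_meet_ler].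
apply: (mv_le_subl _ _ _).1; apply: mv_le_meet; apply/mv_le_subl.
  exact: mv_meet_lel.
exact: mv_meet_ler.
Qed.

Lemma mv_sub_add_meet x y : x ∧ₘ y ⊕ (x ⊖ y) = x.
Proof. by rewrite mv_subK //; exact: mv_sub_le. Qed.

(** Distributivity gives [e ⊕ m = x ∧ₘ y = m], and [e ≤ₘ ¬ m] allows [m] to be cancelled. *)
Lemma mv_prelinear x y : (x ⊖ y) ∧ₘ (y ⊖ x) = 0.
Proof.
set e := _ ∧ₘ _; pose m := x ∧ₘ y.
have me : e ⊕ m = m.
  rewrite mv_addC mv_add_meetr /m mv_sub_add_meet (mv_meetC x y).
  by rewrite mv_sub_add_meet mv_meetC.
have em : e ≤ₘ ¬ m.
  apply: mv_le_trans (mv_meet_lel _ _) _; apply: mv_le_trans (mv_sub_leN _ _) _.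
  apply: mv_le_neg; exact: mv_meet_ler.
by rewrite -(mv_addK em) me mv_subxx.
Qed.

Definition mv_muln n x := iter n (mv_add x) 0.

Lemma mv_muln_add m n x : mv_muln (m + n) x = mv_muln m x ⊕ mv_muln n x.
Proof. by rewrite /mv_muln; elim: m => [|m IH] /=; rewrite ?mv_add0x// IH mv_addA. Qed.

(** With [t] the meet in the conclusion, [t ⊖ y] lies below both [x] and [z], so it is [0] and [t]
    is already below [y]. *)
Lemma mv_meet_add_eq0 x y z : x ∧ₘ z = 0 -> y ∧ₘ z = 0 -> (x ⊕ y) ∧ₘ z = 0.
Proof.
move=> xz yz; set t := _ ∧ₘ _; apply: mv_lex0; rewrite -yz.
apply: mv_le_meet; last exact: mv_meet_ler.
rewrite -[y]mv_addx0; apply: (mv_le_subl _ _ _).1; rewrite -xz; apply: mv_le_meet.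
  by apply/mv_le_subl; rewrite mv_addC; exact: mv_meet_lel.
exact: mv_le_trans (mv_sub_le _ _) (mv_meet_ler _ _).
Qed.

Lemma mv_meet_muln_eq0 n x z : x ∧ₘ z = 0 -> mv_muln n x ∧ₘ z = 0.
Proof.
move=> xz; elim: n => [|n IH]; last exact: mv_meet_add_eq0.
by apply: mv_lex0; exact: mv_meet_lel.
Qed.

End MVOrder.
#[global] Hint Resolve mv_le_refl mv_le0x mv_lex1 : core.

(** * Prime ideals and chain quotients *)

Definition mv_ideal {A : mvAlgType} (J : set A) : Prop :=
  [/\ J mv_zero, forall x y, J x -> J y -> J (x ⊕ y)
    & forall x y, x ≤ₘ y -> J y -> J x].

Definition mv_prime_ideal {A : mvAlgType} (J : set A) : Prop :=
  mv_ideal J /\ forall x y, J (x ⊖ y) \/ J (y ⊖ x).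

Lemma mv_prime_ideal_avoiding (A : mvAlgType) (a : A) : a <> mv_zero ->
  exists2 J : set A, mv_prime_ideal J & ~ J a.
Proof.
move=> a0.
(* [Q] does not ask for [J 0]: Zorn's lemma also needs the empty chain, whose union is
   empty.  Maximality puts [0] back. *)
pose Q (J : set A) := [/\ ~ J a, forall x y, J x -> J y -> J (x ⊕ y)
  & forall x y, x ≤ₘ y -> J y -> J x].
have [|J [[Ja JD Jle] Jmax]] := @Zorn_bigcup A Q.
  move=> F FQ Ftot; split.
  - by move=> [X FX Xa]; have [] := FQ _ FX.
  - move=> x y [X FX Xx] [Y FY Yy]; have [_ XD _] := FQ _ FX.
    have [_ YD _] := FQ _ FY; have [XY|YX] := Ftot _ _ FX FY.
      by exists Y => //; apply: YD => //; exact: XY.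
    by exists X => //; apply: XD => //; exact: YX.
  - move=> x y xy [X FX Xy]; have [_ _ Xle] := FQ _ FX.
    by exists X => //; exact: Xle xy Xy.
(* Since [J 0] is not known yet, [0] is adjoined by hand; [gen u] is the ideal generated by [J] and
   [u]. *)
pose J0 p := p = mv_zero \/ J p.
pose gen u : set A := [set z | exists p n, J0 p /\ z ≤ₘ p ⊕ mv_muln n u].
have JJ p p' : J0 p -> J0 p' -> J0 (p ⊕ p').
  move=> [->|Jp] [->|Jp']; rewrite ?mv_add0x ?mv_addx0; [by left|by right|by right|].
  by right; exact: JD.
(* Otherwise [gen u] would satisfy [Q] and properly extend [J]. *)
have gena u : ~ J u -> gen u a.
  move=> Ju; apply: contrapT => na; apply: (Jmax (gen u)); last split=> //.
  - split=> [x Jx|JG]; first by exists x, O; split; [right|rewrite mv_addx0].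
    apply/Ju/JG; exists mv_zero, 1%N; split; first by left.
    by rewrite mv_add0x /mv_muln /= mv_addx0.
  - move=> x y [p [n [Jp xp]]] [p' [n' [Jp' yp]]].
    exists (p ⊕ p'), (n + n')%N; split; first exact: JJ.
    rewrite mv_muln_add -mv_addA (mv_addCA p') mv_addA; exact: mv_le_add.
  - move=> x y xy [p [n [Jp yp]]]; exists p, n; split=> //; exact: mv_le_trans xy yp.
exists J => //; split.
  (* The case [u = 0] of [gena]: were [0] outside [J], then [a] would lie below some [p] in [J0]. *)
  split=> //; apply: contrapT => /gena[p [n [Jp]]].
  have -> : mv_muln n (mv_zero : A) = mv_zero.
    by elim: n => // n IH; rewrite /mv_muln /= -/(mv_muln n _) IH mv_addx0.
  rewrite mv_addx0; case: Jp => [->/mv_lex0//|Jp ap]; exact/Ja/(Jle _ _ ap).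
move=> x y; apply: contrapT => /not_orP[/gena[p [n [Jp ap]]] /gena[p' [n' [Jp' ap']]]].
(* Multiples of [x ⊖ y] and of [y ⊖ x] have meet [0] by prelinearity; adding [p ⊕ p'] to that meet
   gives an upper bound of [a]. *)
have a_pp : a ≤ₘ p ⊕ p'.
  rewrite -[p ⊕ p']mv_addx0.
  have <- : mv_muln n (x ⊖ y) ∧ₘ mv_muln n' (y ⊖ x) = mv_zero.
    apply: mv_meet_muln_eq0; rewrite mv_meetC; apply: mv_meet_muln_eq0.
    by rewrite mv_meetC mv_prelinear.
  rewrite mv_add_meetr; apply: mv_le_meet.
    apply: mv_le_trans ap _; rewrite mv_addAC; exact: mv_le_addr.
  apply: mv_le_trans ap' _; rewrite -mv_addA; exact: mv_le_addl.
case: (JJ _ _ Jp Jp') => [pp|]; first by move: a_pp; rewrite pp => /mv_lex0.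
by move=> /(Jle _ _ a_pp).
Qed.

Section IdealQuotient.
Variables (A : mvAlgType) (J : set A) (idJ : mv_ideal J).
Implicit Types x y z : A.

Definition ideal_eq : rel {classic A} :=
  fun x y => `[< J ((x : A) ⊖ y) /\ J ((y : A) ⊖ x) >].

Fact ideal_eq_refl : reflexive ideal_eq.
Proof. by move=> x; apply/asboolP; rewrite mv_subxx; case: idJ. Qed.

Fact ideal_eq_sym : symmetric ideal_eq.
Proof. by move=> x y; apply/asboolP/asboolP => -[]. Qed.

Fact ideal_eq_trans : transitive ideal_eq.
Proof.
move=> y x z /asboolP[xy yx] /asboolP[yz zy]; apply/asboolP.
have tri (u v w : A) : J (u ⊖ v) -> J (v ⊖ w) -> J (u ⊖ w).
  case: idJ => _ JD Jle uv vw; apply: Jle (JD _ _ uv vw).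
  apply/mv_le_subl; apply: mv_le_trans (mv_le_add_sub u v) _.
  rewrite mv_addCA mv_addC; apply: mv_le_add => //; exact: mv_le_add_sub.
by split; [exact: tri xy yz|exact: tri zy yx].
Qed.

Canonical ideal_equiv :=
  EquivRel ideal_eq ideal_eq_refl ideal_eq_sym ideal_eq_trans.

Definition ideal_quotient : Type := {eq_quot ideal_equiv}.

Definition ideal_class x : ideal_quotient := \pi_({eq_quot ideal_equiv}) x.

Definition ideal_repr (u : ideal_quotient) : A :=
  repr (u : {eq_quot ideal_equiv}).

Lemma ideal_classP x y :
  ideal_class x = ideal_class y <-> J (x ⊖ y) /\ J (y ⊖ x).
Proof. by split=> [/eqmodP/asboolP//|xy]; apply/eqmodP/asboolP. Qed.

Lemma ideal_reprK : cancel ideal_repr ideal_class.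
Proof. by move=> u; rewrite /ideal_class /ideal_repr reprK. Qed.

Definition ideal_add (u v : ideal_quotient) : ideal_quotient :=
  ideal_class (ideal_repr u ⊕ ideal_repr v).
Definition ideal_neg (u : ideal_quotient) : ideal_quotient :=
  ideal_class (¬ ideal_repr u).

(** Translation by [z] does not increase differences, so one summand at a time can be replaced by
    its representative. *)
Lemma ideal_class_add x y :
  ideal_class (x ⊕ y) = ideal_add (ideal_class x) (ideal_class y).
Proof.
have addP z u v : ideal_class u = ideal_class v ->
    ideal_class (u ⊕ z) = ideal_class (v ⊕ z).
  have le s t : (s ⊕ z) ⊖ (t ⊕ z) ≤ₘ s ⊖ t.
    apply/mv_le_subl; rewrite mv_addAC; apply: mv_le_add2r; exact: mv_le_add_sub.
  case: idJ => _ _ Jle.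
  by move=> /ideal_classP[uv vu]; apply/ideal_classP; split; apply: Jle (le _ _) _.
rewrite /ideal_add (addP y x (ideal_repr (ideal_class x))) ?ideal_reprK //.
rewrite mv_addC (mv_addC _ (ideal_repr (ideal_class y))).
by apply: addP; rewrite ideal_reprK.
Qed.

Lemma ideal_class_neg x : ideal_class (¬ x) = ideal_neg (ideal_class x).
Proof.
rewrite /ideal_neg; apply/ideal_classP; rewrite /mv_sub !mv_negK.
rewrite mv_addC -/(mv_sub _ _) (mv_addC _ (¬ x)) -/(mv_sub _ _).
by have [] := (ideal_classP x (ideal_repr (ideal_class x))).1 (esym (ideal_reprK _)).
Qed.

Fact ideal_addC : commutative ideal_add.
Proof. by move=> u v; rewrite /ideal_add mv_addC. Qed.

Fact ideal_addA : associative ideal_add.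
Proof.
move=> u v w; rewrite -(ideal_reprK u) -(ideal_reprK v) -(ideal_reprK w).
by rewrite -!ideal_class_add mv_addA.
Qed.

Fact ideal_addx0 : right_id (ideal_class mv_zero) ideal_add.
Proof. by move=> u; rewrite -(ideal_reprK u) -ideal_class_add mv_addx0. Qed.

Fact ideal_negK : involutive ideal_neg.
Proof. by move=> u; rewrite -(ideal_reprK u) -!ideal_class_neg mv_negK. Qed.

Fact ideal_addx1 u : ideal_add u (ideal_neg (ideal_class mv_zero)) =
  ideal_neg (ideal_class mv_zero).
Proof.
by rewrite -(ideal_reprK u) -ideal_class_neg -ideal_class_add mv_addx1.
Qed.

Fact ideal_lukasiewicz u v :
  ideal_add (ideal_neg (ideal_add (ideal_neg u) v)) v =
  ideal_add (ideal_neg (ideal_add (ideal_neg v) u)) u.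
Proof.
rewrite -(ideal_reprK u) -(ideal_reprK v).
by rewrite -!(ideal_class_neg, ideal_class_add) mv_lukasiewicz.
Qed.

HB.instance Definition _ := isMVAlgebra.Build ideal_quotient
  ideal_addC ideal_addA ideal_addx0 ideal_negK ideal_addx1 ideal_lukasiewicz.

End IdealQuotient.

Definition mv_hom (A B : mvAlgType) (f : A -> B) : Prop :=
  [/\ {morph f : x y / mv_add x y}, {morph f : x / mv_neg x} & f mv_zero = mv_zero].

Lemma mv_chain_quotient (A : mvAlgType) (a : A) : a <> mv_zero ->
  exists (C : mvAlgType) (f : A -> C), [/\ mv_chain C, mv_hom f & f a <> mv_zero].
Proof.
move=> /mv_prime_ideal_avoiding[J [idJ prJ] Ja]; have [J0 _ Jle] := idJ.
exists (ideal_quotient idJ : mvAlgType), (ideal_class idJ); split.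
- move=> u v; rewrite -(ideal_reprK u) -(ideal_reprK v).
  suff le x y : J (x ⊖ y) -> ideal_class idJ x ≤ₘ ideal_class idJ y.
    by case: (prJ (ideal_repr u) (ideal_repr v)) => /le; [left|right].
  move=> Jxy; apply/mv_sub_eq0; rewrite /mv_sub /mv_add/= /mv_neg/=.
  rewrite -!(ideal_class_neg, ideal_class_add); apply/ideal_classP.
  split; first by apply: Jle Jxy; exact: mv_sub_le.
  by rewrite (mv_sub_eq0 _ _).2.
- split=> //.
  + by move=> x y; exact: ideal_class_add.
  + by move=> x; exact: ideal_class_neg.
- by move=> /ideal_classP[+ _]; rewrite /mv_sub mv_addx0 mv_negK.
Qed.

(** * Chang's group of a chain *)

Section ChainSums.
Variables (C : mvAlgType) (chainC : mv_chain C).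
Implicit Types (x y a c d : C) (σ τ : nat * C).
Local Notation "0" := (mv_zero : C) : mv_scope.
Local Notation "1" := (mv_one : C) : mv_scope.

Lemma mv_sub_add x y z : x ⊖ (y ⊕ z) = x ⊖ y ⊖ z :> C.
Proof. by rewrite /mv_sub mv_negK mv_addA. Qed.

Lemma mv_mulA x y z : x ⊙ (y ⊙ z) = x ⊙ y ⊙ z :> C.
Proof. by rewrite /mv_mul !mv_negK mv_addA. Qed.

(** Both sides stand for [a + c + d - 1] cut off at [0]. Subtracting [¬ d] as [a] followed by
    [¬ d ⊖ a] turns the left side into [c ⊙ (a ⊕ d)]. *)
Lemma mv_add_mul_exchange a c d :
  a ≤ₘ ¬ c -> a ≤ₘ ¬ d -> (a ⊕ c) ⊙ d = (a ⊕ d) ⊙ c.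
Proof.
move=> ac ad; rewrite mv_mulE -(mv_subK ad) (mv_addC _ a) mv_sub_add.
rewrite (mv_addC a c) (mv_addK (mv_leN ac)) (mv_mulC _ c) mv_mulE.
by rewrite {2}/mv_sub mv_negK (mv_addC d).
Qed.

Lemma mv_mul_add_exchange a c d :
  ¬ c ≤ₘ a -> ¬ d ≤ₘ a -> a ⊙ c ⊕ d = a ⊙ d ⊕ c.
Proof.
move=> /mv_le_neg ac /mv_le_neg ad; apply: mv_neg_inj.
have := mv_add_mul_exchange ac ad.
by rewrite /mv_mul !mv_negK.
Qed.

Lemma mv_chain_add_neq1 x y : x ⊕ y <> 1 -> x ≤ₘ ¬ y.
Proof.
by case: (chainC x (¬ y)) => // /mv_Nle; rewrite mv_addC.
Qed.

(** Here [a = a ⊙ d ⊕ ¬ d]; as adding [c] does not reach [1], the summand [¬ d] can be subtracted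
    again. *)
Lemma mv_chain_mul_add a c d :
  ¬ d ≤ₘ a -> a ⊕ c <> 1 -> a ⊙ d ⊕ c = (a ⊕ c) ⊙ d.
Proof.
move=> da ac; rewrite [RHS]mv_mulE -{2}(mv_subK da) mv_addAC mv_addK //.
apply: mv_chain_add_neq1; rewrite mv_addAC -mv_mulE.
by rewrite (mv_add_mulK da).
Qed.

(* A state [(m, x)] with [x <> 1] stands for [m + x] in Chang's ordered group
   [Z * C] of the chain [C], and [carry c] for the translation by [c]. *)
Definition carry c σ : nat * C :=
  if `[< σ.2 ⊕ c = 1 >] then (σ.1.+1, σ.2 ⊙ c) else (σ.1, σ.2 ⊕ c).

Lemma carry_eq1 c σ : σ.2 ⊕ c = 1 -> carry c σ = (σ.1.+1, σ.2 ⊙ c).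
Proof. by move=> h; rewrite /carry asboolT. Qed.

Lemma carry_neq1 c σ : σ.2 ⊕ c <> 1 -> carry c σ = (σ.1, σ.2 ⊕ c).
Proof. by move=> h; rewrite /carry asboolF. Qed.

(** The cases where both, one or neither of [c], [d] overflows are the three exchange identities
    above. Commuting translations make sums independent of order without an addition of states. *)
Lemma carryC c d σ : carry c (carry d σ) = carry d (carry c σ).
Proof.
have mixed x y : σ.2 ⊕ x <> 1 -> σ.2 ⊕ y = 1 ->
    carry x (carry y σ) = carry y (carry x σ).
  move=> hx hy; rewrite (carry_eq1 hy) (carry_neq1 hx).
  have yle : ¬ y ≤ₘ σ.2 by apply/mv_Nle; rewrite mv_addC.
  have e := mv_chain_mul_add yle hx.
  rewrite carry_neq1 /= ?carry_eq1 /= ?e //; first by rewrite mv_addAC hy mv_add1x.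
  move=> h; apply: hx; apply: mv_le1x; rewrite -h; exact: mv_mul_lel.
case: (pselect (σ.2 ⊕ c = 1)) => hc; case: (pselect (σ.2 ⊕ d = 1)) => hd.
- rewrite (carry_eq1 hc) (carry_eq1 hd) /carry /=.
  have -> : σ.2 ⊙ c ⊕ d = σ.2 ⊙ d ⊕ c.
    by apply: mv_mul_add_exchange; apply/mv_Nle; rewrite mv_addC.
  by rewrite -!mv_mulA (mv_mulC c).
- by apply/esym; exact: mixed.
- exact: mixed.
- rewrite (carry_neq1 hc) (carry_neq1 hd) /carry /= mv_addAC.
  by rewrite (@mv_add_mul_exchange σ.2 c d) //; exact: mv_chain_add_neq1.
Qed.

Definition state_le σ τ : Prop :=
  (σ.1 < τ.1)%N \/ σ.1 = τ.1 /\ σ.2 ≤ₘ τ.2.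

Lemma state_le_refl σ : state_le σ σ.
Proof. by right. Qed.

Lemma state_le_trans τ σ ρ : state_le σ τ -> state_le τ ρ -> state_le σ ρ.
Proof.
move=> [lt1|[e1 le1]] [lt2|[e2 le2]]; [left|left|left|right]; try lia.
by split; [lia|exact: mv_le_trans le1 le2].
Qed.

Lemma state_le_carry c σ τ : state_le σ τ -> state_le (carry c σ) (carry c τ).
Proof.
case: (pselect (σ.2 ⊕ c = 1)) => s1; case: (pselect (τ.2 ⊕ c = 1)) => t1;
  rewrite ?(carry_eq1 s1) ?(carry_eq1 t1) ?(carry_neq1 s1) ?(carry_neq1 t1).
- move=> [lt|[e le]]; [left; rewrite /=; lia|right => /=; split; first lia].
  exact: mv_le_mul2r.
- move=> [lt|[e le]].
    (* Only [σ] carries. If [τ] was exactly one unit ahead, [c] lies between the two second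
       components. *)
    case: (ltngtP σ.1.+1 τ.1) => h; [by left|lia|right; split => //=].
    exact: mv_le_trans (mv_mul_ler _ _) (mv_le_addl _ _).
  by case: t1; apply: mv_le1x; rewrite -s1; exact: mv_le_add2r.
- by move=> [lt|[e le]]; left => /=; lia.
- move=> [lt|[e le]]; [by left|right; split=> //=].
  exact: mv_le_add2r.
Qed.

Lemma state_le_carryl c σ : state_le σ (carry c σ).
Proof.
case: (pselect (σ.2 ⊕ c = 1)) => h; first by rewrite carry_eq1 //; left.
by rewrite carry_neq1 //; right; split=> //=; exact: mv_le_addr.
Qed.

(** Without overflow [c] is recovered as [(c ⊕ σ.2) ⊖ σ.2], which would be [0] if the translation
    did not move [σ] up. *)
Lemma carry_not_le c σ : c <> 0 -> ~ state_le (carry c σ) σ.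
Proof.
move=> c0; case: (pselect (σ.2 ⊕ c = 1)) => h.
  by rewrite carry_eq1 // => -[|[]] /=; lia.
rewrite carry_neq1 // => -[|[_ /= le]] /=; first lia.
apply: c0; have := mv_chain_add_neq1 h => /mv_leN /mv_addK.
have -> : c ⊕ σ.2 = σ.2 by rewrite mv_addC; apply: mv_le_anti => //; exact: mv_le_addr.
by rewrite mv_subxx.
Qed.

Variable v : nat -> C.

(** Summing over indices rather than elements lets multiplicities serve as integer coefficients of
    linear forms. *)
Definition chain_sum (s : seq nat) : nat * C :=
  foldr (fun i => carry (v i)) (0%N, 0) s.

Lemma chain_sum_insert i s t :
  chain_sum (s ++ i :: t) = carry (v i) (chain_sum (s ++ t)).
Proof. by elim: s => //= j s ->; exact: carryC. Qed.

Lemma perm_chain_sum s t : perm_eq s t -> chain_sum s = chain_sum t.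
Proof.
elim: s t => [|i s IH] t st; first by move: st; rewrite perm_sym => /perm_nilP ->.
have /splitPr E : i \in t by rewrite -(perm_mem st) mem_head.
case: E st => t1 t2 st; rewrite chain_sum_insert -(IH (t1 ++ t2)) //.
rewrite -(perm_cons i) (perm_trans st) // -[i :: t2]cat1s.
by rewrite -[i :: (t1 ++ t2)]cat1s perm_catCA.
Qed.

Lemma chain_sum_le_catl u s t : state_le (chain_sum s) (chain_sum t) ->
  state_le (chain_sum (u ++ s)) (chain_sum (u ++ t)).
Proof. by move=> st; elim: u => //= i u IH; exact: state_le_carry. Qed.

Lemma chain_sum_le_cat s t s' t' :
  state_le (chain_sum s) (chain_sum t) -> state_le (chain_sum s') (chain_sum t') ->
  state_le (chain_sum (s ++ s')) (chain_sum (t ++ t')).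
Proof.
move=> st /(chain_sum_le_catl s) /state_le_trans; apply.
rewrite !(perm_chain_sum (permEl (perm_catC _ t'))); exact: chain_sum_le_catl.
Qed.

Lemma chain_sum_lt_nseq k s : v 0%N <> 0 -> (0 < k)%N ->
  ~ state_le (chain_sum (nseq k 0%N ++ s)) (chain_sum s).
Proof.
move=> v0; case: k => // k _; elim: k => [|k IH]; first exact: carry_not_le.
by move=> h; apply: IH; apply: state_le_trans h; exact: state_le_carryl.
Qed.

End ChainSums.

(** * Fourier-Motzkin elimination *)

Local Open Scope ring_scope.

Section FourierMotzkin.
Variable F : realFieldType.

(** Either list may be empty, so [t] is built up: first a lower bound of [B], then raised to each
    element of [A]. *)
Lemma seq_separation (A B : seq F) :
  (forall a b, a \in A -> b \in B -> a <= b) ->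
  exists t, (forall a, a \in A -> a <= t) /\ (forall b, b \in B -> t <= b).
Proof.
elim: A => [|a A IH] AB.
  elim: B {AB} => [|b B [t [_ IH]]]; first by exists 0.
  exists (Num.min b t); split=> // c; rewrite inE => /predU1P[->|/IH cB].
    by rewrite ge_min lexx.
  by rewrite ge_min cB orbT.
have [|t [At Bt]] := IH.
  by move=> c b cA; apply: AB; rewrite inE cA orbT.
exists (Num.max a t); split=> [c|b bB].
  by rewrite inE => /predU1P[->|/At cA]; rewrite le_max ?lexx ?cA ?orbT.
by rewrite ge_max Bt // andbT AB // mem_head.
Qed.

(* A form [p] stands for [\sum_i p i * x_i], and [P] for a cone of forms that are
   nonnegative in some ordered group; [P_const] says that [x_0 > 0] there. *)
Variable P : (nat -> int) -> Prop.
Hypothesis PD : forall p r, P p -> P r -> P (fun i => p i + r i).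
Hypothesis P_const : forall p, P p -> (forall i, (0 < i)%N -> p i = 0) -> 0 <= p 0%N.

Lemma cone_scale p (m : int) : 0 < m -> P p -> P (fun i => p i * m).
Proof.
case: m => // -[//|n] _ Pp; elim: n => [|n IH].
  by have -> : (fun i => p i * 1%Z) = p by apply/funext => i; rewrite mulr1.
have -> : (fun i => p i * Posz n.+2) = (fun i => p i + p i * Posz n.+1).
  by apply/funext => i; lia.
exact: PD.
Qed.

Definition form_eval N (p : nat -> int) (q : nat -> F) : F :=
  \sum_(i < N) (p i)%:~R * q i.

Lemma fourier_motzkin N (L : seq (nat -> int)) :
  (forall p, p \in L -> P p /\ forall i, (N < i)%N -> p i = 0) ->
  exists q : nat -> F, q 0%N = 1 /\ forall p, p \in L -> 0 <= form_eval N.+1 p q.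
Proof.
elim: N L => [|N IH] L LP.
  exists (fun=> 1); split=> // p /LP[Pp p0].
  by rewrite /form_eval big_ord_recl big_ord0 addr0 mulr1 ler0z; exact: P_const.
(* For [p] in [Lpos] and [r] in [Lneg] both multipliers are positive integers, so [comb p r] stays
   in the cone, and its coefficient at [N.+1] cancels. *)
pose comb (p r : nat -> int) i := p i * (- r N.+1) + r i * p N.+1.
pose Lpos := [seq p : nat -> int <- L | 0 < p N.+1].
pose Lneg := [seq p : nat -> int <- L | p N.+1 < 0].
pose L' := [seq p : nat -> int <- L | p N.+1 == 0] ++
  [seq comb p r | p <- Lpos, r <- Lneg].
have [p|q [q0 qL']] := IH L'.
  rewrite mem_cat => /orP[|/allpairsP[[p1 r1] /= []]].
    rewrite mem_filter => /andP[/eqP pN /LP[Pp p0]]; split=> // i.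
    by rewrite leq_eqVlt => /predU1P[<-//|/p0].
  rewrite !mem_filter => /andP[pN /LP[Pp p0]] /andP[rN /LP[Pr r0]] ->; split.
    by apply: PD; apply: cone_scale; rewrite ?oppr_gt0.
  move=> i; rewrite leq_eqVlt /comb => /predU1P[<-|/[dup]/p0 -> /r0 ->].
    by rewrite mulrN mulrC addNr.
  by rewrite !mul0r addr0.
pose E p := form_eval N.+1 p q.
(* The bound that [p] puts on the eliminated variable: a lower one for [Lpos], an upper one for
   [Lneg]. Nonnegativity of [comb p r] says [b p <= b r]. *)
pose b (p : nat -> int) := - E p / (p N.+1)%:~R.
have [a c|t [tl tu]] := @seq_separation [seq b p | p <- Lpos] [seq b p | p <- Lneg].
  move=> /mapP[p pL ->] /mapP[r rL ->].
  have : 0 <= E (comb p r).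
    by apply: qL'; rewrite mem_cat; apply/orP; right; apply: allpairs_f.
  have -> : E (comb p r) = E p * - (r N.+1)%:~R + E r * (p N.+1)%:~R.
    rewrite /E /form_eval !mulr_suml -big_split /=; apply: eq_bigr => i _.
    by rewrite /comb intrD !intrM intrN; ring.
  move: pL rL; rewrite !mem_filter => /andP[p0 _] /andP[r0 _].
  rewrite /b ler_pdivrMr ?ltr0z // mulrAC ler_ndivlMr ?ltrz0 //; lra.
exists (fun i => if i == N.+1 then t else q i); split=> // p pL.
rewrite /form_eval big_ord_recr /= eqxx.
have -> : \sum_(i < N.+1) (p i)%:~R * (if (i : nat) == N.+1 then t else q i) = E p.
  by apply: eq_bigr => i _; rewrite ltn_eqF.
have [p0|p0|p0] := ltgtP (p N.+1) 0.
- have := tu (b p); rewrite map_f ?mem_filter ?p0 // => /(_ isT).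
  rewrite /b ler_ndivlMr ?ltrz0 //; lra.
- have := tl (b p); rewrite map_f ?mem_filter ?p0 // => /(_ isT).
  rewrite /b ler_pdivrMr ?ltr0z //; lra.
- rewrite p0 mulr0z mul0r addr0; apply: qL'; rewrite mem_cat mem_filter p0 eqxx pL //.
Qed.

End FourierMotzkin.

(** * Partial embeddings into the unit interval *)

Lemma sum_count_mem (F : realFieldType) (q : nat -> F) N (s : seq nat) :
  all (fun i => (i < N)%N) s ->
  \sum_(i < N) (count_mem (i : nat) s)%:R * q i = \sum_(i <- s) q i.
Proof.
elim: s => [_|j s IH /= /andP[jN sN]].
  by rewrite big_nil big1 // => i _; rewrite mul0r.
rewrite big_cons -IH //.
under eq_bigr do rewrite natrD mulrDl; rewrite big_split /=; congr (_ + _).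
rewrite (bigD1 (Ordinal jN)) //= eqxx mul1r big1 ?addr0 // => i ij.
by rewrite eq_sym (_ : (i : nat) == j = false) ?mul0r //; apply/negbTE.
Qed.

Section ChainApproximation.
Variables (F : realFieldType) (C : mvAlgType) (chainC : mv_chain C).
Local Notation "0" := (mv_zero : C) : mv_scope.
Local Notation "1" := (mv_one : C) : mv_scope.

(** An inequality between the sums over [s] and [t] is read as the form counting [t] minus [s].
    Concatenation adds such forms, so they make up a cone to which [fourier_motzkin] applies. *)
Lemma chain_sum_approximation (v : nat -> C) N (K : seq (seq nat)) :
  v 0%N <> 0%mv -> (forall s, s \in K -> all (fun i => (i <= N)%N) s) ->
  exists q : nat -> F, q 0%N = 1%R /\
    forall s t, s \in K -> t \in K -> state_le (chain_sum v s) (chain_sum v t) ->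
      \sum_(i <- s) q i <= \sum_(i <- t) q i.
Proof.
move=> v0 KN.
pose form (st : seq nat * seq nat) i : int :=
  (count_mem i st.2)%:Z - (count_mem i st.1)%:Z.
pose le (st : seq nat * seq nat) := state_le (chain_sum v st.1) (chain_sum v st.2).
pose P p := exists2 st, p = form st & le st.
have PD p r : P p -> P r -> P (fun i => p i + r i).
  move=> [[s t] -> st] [[s' t'] -> st']; exists (s ++ s', t ++ t').
    by apply/funext => i; rewrite /form /= !count_cat; lia.
  exact: chain_sum_le_cat.
have P_const p : P p -> (forall i, (0 < i)%N -> p i = 0%R) -> 0 <= p 0%N.
  move=> [[s t] -> st] p0; rewrite leNgt; apply/negP => lt0.
  (* [s] would be a permutation of [t] with [k] extra copies of index [0], against the strict
     positivity of [v 0]. *)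
  pose k := (count_mem 0%N s - count_mem 0%N t)%N.
  apply: (@chain_sum_lt_nseq _ chainC v k t v0).
    by move: lt0; rewrite /form /k /=; lia.
  rewrite -(@perm_chain_sum _ chainC v s) //; apply/allP => i _ /=.
  rewrite count_cat count_nseq; apply/eqP.
  by case: i => [|i]; [move: lt0|have := p0 i.+1 isT]; rewrite /form /k /=; lia.
pose L := [seq form st | st <- [seq (s, t) | s <- K, t <- K] & `[< le st >]].
have [p|q [q0 qL]] := fourier_motzkin F PD P_const (N := N) (L := L).
  move=> /mapP[st]; rewrite mem_filter => /andP[/asboolP lest].
  move=> /allpairsP[[s t] /= [sK tK ste]] ->; split; first by exists st.
  move=> i iN; rewrite /form ste /=.
  have c0 u : u \in K -> count_mem i u = 0%N.
    move=> /KN /allP uN; apply/count_memPn; apply/negP => /uN; lia.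
  by rewrite !c0.
exists q; split=> // s t sK tK st.
have : 0 <= form_eval N.+1 (form (s, t)) q.
  by apply/qL/map_f; rewrite mem_filter asboolT //=; exact: allpairs_f.
rewrite /form_eval /form /=; under eq_bigr do rewrite intrB mulrBl.
by rewrite sumrB !sum_count_mem ?subr_ge0 //; exact: KN.
Qed.

(** The unit is the state [(1, 0)], not [(0, 1)]. *)
Lemma carry_zero_state (x : C) : 0%mv <> 1%mv ->
  carry x (0%N, 0%mv) = if `[< x = 1%mv >] then (1%N, 0%mv) else (0%N, x).
Proof.
move=> C01; rewrite /carry /= mv_add0x; case: asboolP => // _; congr pair.
by apply: mv_lex0; exact: mv_mul_lel.
Qed.

(** The hypothesis still allows [x ⊕ y = 1]; then [x ⊙ y = 0], so nothing remains after the
    carry. *)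
Lemma carry_carry_add (x y : C) : 0%mv <> 1%mv -> x ≤ₘ ¬ y ->
  carry x (carry y (0%N, 0%mv)) = carry (x ⊕ y) (0%N, 0%mv).
Proof.
move=> C01 xy; have [y1|y1] := pselect (y = 1%mv).
  have -> : x = 0%mv by apply: mv_lex0; rewrite -mv_neg1 -y1.
  by rewrite mv_add0x !carry_zero_state // asboolT // carry_neq1 /= mv_addx0.
rewrite !carry_zero_state // (asboolF y1) /carry /= (mv_addC y).
by case: asboolP => // _; rewrite mv_mulC (mv_mul_eq0 _ _).2.
Qed.

Lemma carry_carry_ge1 (x y : C) : 0%mv <> 1%mv -> x ⊕ y = 1%mv ->
  state_le (carry 1%mv (0%N, 0%mv)) (carry x (carry y (0%N, 0%mv))).
Proof.
move=> C01 xy; have [y1|y1] := pselect (y = 1%mv).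
  by rewrite y1; exact: state_le_carryl.
rewrite !carry_zero_state // asboolT // (asboolF y1) carry_eq1 /=.
  by right; split.
by rewrite mv_addC.
Qed.

Lemma chain_partial_embedding (a : C) (X : set C) : a <> 0%mv -> finite_set X ->
  exists f : C -> unit_interval F,
    [/\ f a <> mv_zero,
        forall x y, X x -> X y -> X (x ⊕ y) -> f (x ⊕ y) = f x ⊕ f y,
        forall x, X x -> X (¬ x) -> f (¬ x) = ¬ f x
      & X 0%mv -> f 0%mv = mv_zero].
Proof.
move=> a0 /(@finite_seqP {classic C})[e XE].
have C01 : 0%mv <> 1%mv by move=> h; apply: a0; apply: mv_lex0; rewrite h.
(* Index [0] holds [a], whose value is normalised to [1]; index [1] holds the unit by which all
   values are divided; the list of [X] fills the indices up to [N]. *)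
pose v i : C := match i with
  | 0%N => a | 1%N => 1%mv | i.+2 => nth (0%mv : {classic C}) e i end.
pose N := (size e).+1.
have [r rN] : {r : seq nat | forall i, (i \in r) = (i <= N)%N}.
  by exists (iota 0 N.+1) => i; rewrite mem_iota.
(* Sums of at most two terms suffice: they express positivity, monotonicity and additivity. *)
pose K := [::] :: [seq [:: i] | i <- r] ++ [seq [:: i; j] | i <- r, j <- r].
have K1 i : (i <= N)%N -> [:: i] \in K.
  by move=> iN; rewrite inE mem_cat map_f ?orbT // rN.
have K2 i j : (i <= N)%N -> (j <= N)%N -> [:: i; j] \in K.
  by move=> iN jN; rewrite inE mem_cat allpairs_f ?orbT // rN.
have [//|s|q [q0 qle]] := @chain_sum_approximation v N K.
  rewrite inE mem_cat => /predU1P[->//|/orP[/mapP[i + ->]|/allpairsP[[i j] /= [+ + ->]]]];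
    by rewrite !rN /= => -> // ->.
have q_ge0 i : (i <= N)%N -> 0 <= q i.
  move=> iN; have := qle [::] [:: i] (mem_head _ _) (K1 _ iN).
  by rewrite big_nil big_seq1; apply; exact: state_le_carryl.
have q_le i j : (i <= N)%N -> (j <= N)%N ->
    state_le (carry (v i) (0%N, 0%mv)) (carry (v j) (0%N, 0%mv)) -> q i <= q j.
  by move=> iN jN h; have := qle _ _ (K1 _ iN) (K1 _ jN) h; rewrite !big_seq1.
have q_eq i j : (i <= N)%N -> (j <= N)%N -> v i = v j -> q i = q j.
  by move=> iN jN h; apply/eqP; rewrite eq_le !q_le // h; exact: state_le_refl.
have q_le1 i : (i <= N)%N -> q i <= q 1%N.
  move=> iN; apply: q_le => //=; rewrite !carry_zero_state // (asboolT (erefl _)).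
  by case: asboolP => _; [exact: state_le_refl|left].
have q1_gt0 : 0 < q 1%N.
  by apply: lt_le_trans (q_le1 0%N isT); rewrite q0.
have q_add i j k : (i <= N)%N -> (j <= N)%N -> (k <= N)%N ->
    v i ≤ₘ ¬ v j -> v k = v i ⊕ v j -> q k = q i + q j.
  move=> iN jN kN ij kE.
  have e2 : chain_sum v [:: i; j] = chain_sum v [:: k].
    by rewrite /= carry_carry_add // kE.
  have := qle _ _ (K2 _ _ iN jN) (K1 _ kN); have := qle _ _ (K1 _ kN) (K2 _ _ iN jN).
  rewrite e2 big_seq1 big_cons big_seq1.
  move=> /(_ (state_le_refl _)) le1 /(_ (state_le_refl _)) le2.
  by apply/eqP; rewrite eq_le le1 le2.
have q_min i j k : (i <= N)%N -> (j <= N)%N -> (k <= N)%N ->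
    v k = v i ⊕ v j -> q k = Num.min (q i + q j) (q 1%N).
  (* Either the sum is exact and at most the unit, or it is truncated, so that [v k = 1] and
     [q i + q j] is at least [q 1]. *)
  move=> iN jN kN kE; case: (chainC (v i) (¬ v j)) => [ij|/mv_Nle].
    by rewrite -(q_add _ _ _ iN jN kN ij kE); apply/esym/min_idPl; exact: q_le1.
  rewrite mv_addC => ij; rewrite (q_eq k 1%N) ?kE //; apply/esym/min_idPr.
  have := qle _ _ (K1 1%N isT) (K2 _ _ iN jN); rewrite big_seq1 big_cons big_seq1; apply.
  exact: carry_carry_ge1.
(* Elements outside the range of the list get the default index [0]; nothing is required of [f]
   there. *)
have /choice[idx idxP] (x : C) : exists i, (i <= N)%N /\
    ((exists2 j, (j <= N)%N & v j = x) -> v i = x).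
  have [[j jN jx]|nj] := pselect (exists2 j, (j <= N)%N & v j = x).
    by exists j.
  by exists 0%N.
have idxN x : (idx x <= N)%N by have [] := idxP x.
have idxa : v (idx a) = a by apply: (idxP a).2; exists 0%N.
have idxX x : X x -> v (idx x) = x.
  rewrite XE /= => xe; apply: (idxP x).2.
  exists (index (x : {classic C}) e).+2; last exact: (@nth_index {classic C} _ x e xe).
  by rewrite /N ltnS index_mem.
have fP x : 0 <= q (idx x) / q 1%N <= 1.
  by rewrite divr_ge0 ?q_ge0 ?(ltW q1_gt0) //= ler_pdivrMr // mul1r q_le1.
exists (fun x => exist (fun t : F => 0 <= t <= 1) _ (fP x)); split.
(* The index chosen for [a] may differ from [0], but [q_eq] gives it the same value, so [f a] is the
   inverse of [q 1]. *)
- move=> /(congr1 sval) /= /eqP.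
  rewrite (q_eq _ 0%N) // q0 mul1r invr_eq0 => /eqP h.
  by move: q1_gt0; rewrite h ltxx.
- move=> x y Xx Xy Xxy; apply: val_inj => /=.
  rewrite (q_min (idx x) (idx y)) ?idxX // -mulrDl.
  by rewrite minr_pMl ?invr_ge0 ?ltW // divff // lt0r_neq0.
- move=> x Xx Xnx; apply: val_inj => /=.
  have := q_add (idx x) (idx (¬ x)) 1%N (idxN _) (idxN _) isT.
  rewrite !idxX // mv_negK mv_addxN => /(_ (mv_le_refl _) erefl) h.
  rewrite -[X in X - _](divff (lt0r_neq0 q1_gt0)) -mulrBl {1}h.
  by congr (_ / _); lra.
- move=> X0; apply: val_inj => /=.
  have := q_add (idx 0%mv) (idx 0%mv) (idx 0%mv) (idxN _) (idxN _) (idxN _).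
  rewrite idxX // mv_addx0 => /(_ (mv_le0x _) erefl) h.
  by rewrite (_ : q _ = 0%R) ?mul0r //; lra.
Qed.

End ChainApproximation.

Lemma mv_partial_embedding (F : realFieldType) (M : mvAlgType) (a : M) (X : set M) :
  a <> mv_zero -> finite_set X ->
  exists f : M -> unit_interval F,
    [/\ f a <> mv_zero,
        forall x y, X x -> X y -> X (x ⊕ y) -> f (x ⊕ y) = f x ⊕ f y,
        forall x, X x -> X (¬ x) -> f (¬ x) = ¬ f x
      & X mv_zero -> f mv_zero = mv_zero].
Proof.
move=> /mv_chain_quotient[C [h [chC [hD hN h0] ha]]] finX.
have [f [fa fD fN f0]] := chain_partial_embedding F chC ha (finite_image h finX).
exists (f \o h); split=> //=.
- by move=> x y Xx Xy Xxy; rewrite hD fD // -hD; exists (x ⊕ y).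
- by move=> x Xx Xnx; rewrite hN fN // -hN; exists (¬ x).
- by move=> X0; rewrite h0 f0 // -h0; exists mv_zero.
Qed.

(** * Regular ultrafilters and ultrapowers *)

Definition containing (T : Type) (x : T) : set (finite_subset T) := [set X | sval X x].

Lemma fine_ultrafilter (T : Type) :
  exists U : set_system (finite_subset T), UltraFilter U /\ forall x, U (containing x).
Proof.
(* The filter generated by the cones of finite supersets; unions of finite sets give its closure
   under intersection. *)
pose G : set_system (finite_subset T) :=
  [set A | exists Y : finite_subset T,
    forall Z : finite_subset T, sval Y `<=` sval Z -> A Z].
have GF : ProperFilter G.
  split.
    by move=> [Y /(_ Y)]; exact.
  split.
  - by exists (exist _ set0 (finite_set0 _)).
  - move=> A B [Y YA] [Z ZB].
    have fYZ : finite_set (sval Y `|` sval Z).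
      by rewrite finite_setU; split; exact: svalP.
    exists (exist _ _ fYZ) => W /= YZW; split.
      by apply: YA => x Yx; apply: YZW; left.
    by apply: ZB => x Zx; apply: YZW; right.
  - by move=> A B AB [Y YA]; exists Y => Z /YA /AB.
have [U [UU GU]] := ultraFilterLemma GF; exists U; split=> // x; apply: GU.
by exists (exist _ _ (finite_set1 x)) => Z; apply.
Qed.

(** A finite [X] lies in [containing x] only for its own elements [x]; the singleton of [x] shows
    that distinct points give distinct sets. *)
Lemma fine_filter_regular (T : Type) (U : set_system (finite_subset T)) :
  ProperFilter U -> (forall x, U (containing x)) -> regular_filter T U.
Proof.
move=> PU Ux; split=> //; exists (range (@containing T)); split.
- by move=> _ [x _ <-].
- apply: inj_card_eq => x y _ _ xy.
  have : containing x (exist _ _ (finite_set1 x)) by [].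
  by rewrite xy /containing /=.
- move=> X; apply: sub_finite_set (finite_image (@containing T) (svalP X)).
  by move=> _ [[x _ <-] Xx]; exists x.
Qed.

Section UltrapowerEmbedding.
Variables (alpha : Type) (U : set_system (finite_subset alpha)) (UU : UltraFilter U).
Hypothesis fineU : forall x, U (containing x).
Variables (F : realFieldType) (M : mvAlgType) (j : M -> alpha).
Hypothesis j_inj : injective j.
Local Notation ultrapower := (ultraproduct UU (fun=> unit_interval F)).

(** Coordinate [X] uses a partial homomorphism on the preimage of [X] under [j]. Each identity
    involves at most three elements, so it holds at every [X] containing their images, a set in
    [U]. *)
Lemma ultrapower_hom (a : M) : a <> mv_zero ->
  exists h : M -> ultrapower, mv_hom h /\ h a <> mv_zero.
Proof.
move=> a0.
have /choice[f fP] (X : finite_subset alpha) :=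
  mv_partial_embedding F a0 (finite_preimage (in2W j_inj) (svalP X)).
exists (fun x => ultra_class UU (fun X => f X x)); split.
  split.
  - move=> x y; rewrite /mv_add /= -ultra_class_add; apply/ultra_classP.
    apply: filterS (filterI (filterI (fineU (j x)) (fineU (j y))) (fineU (j (x ⊕ y)))).
    by move=> X [[Xx Xy] Xxy]; have [_ fD _ _] := fP X; exact: fD.
  - move=> x; rewrite /mv_neg /= -ultra_class_neg; apply/ultra_classP.
    apply: filterS (filterI (fineU (j x)) (fineU (j (¬ x)))) => X [Xx Xnx].
    by have [_ _ fN _] := fP X; exact: fN.
  - apply/ultra_classP; apply: filterS (fineU (j mv_zero)) => X X0.
    by have [_ _ _ f0] := fP X; exact: f0.
move=> /ultra_classP Ua; apply: (@filter_not_empty _ U _).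
by apply: filterS Ua => X; have [fa _ _ _] := fP X.
Qed.

Lemma ultrapower_embeds : mv_zero <> mv_one :> M ->
  mv_embeds M (set alpha -> ultrapower).
Proof.
move=> M01.
(* Only the singletons [[set j a]] are needed as indices to separate points. *)
have /choice[h hP] (Y : set alpha) : exists h : M -> ultrapower,
    mv_hom h /\ forall a, a <> mv_zero -> Y = [set j a] -> h a <> mv_zero.
  have [[a [a0 Ya]]|nY] := pselect (exists a, a <> mv_zero /\ Y = [set j a]).
    have [h [hom ha]] := ultrapower_hom a0; exists h; split=> // b _.
    rewrite Ya => ab; have : [set j b] (j a) by rewrite -ab.
    by move=> /= /j_inj <-.
  (* At all other indices any homomorphism serves; nontriviality supplies one that keeps [1]
     nonzero. *)
  have [h [hom _]] := ultrapower_hom (fun e => M01 (esym e)).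
  by exists h; split=> // a a0 Ya; case: nY; exists a.
(* A nonzero [x ⊖ y] would survive at its own index, where [x] and [y] have equal images. *)
have sub0 x y : (fun Y => h Y x) = (fun Y => h Y y) -> x ⊖ y = mv_zero.
  move=> xy; apply: contrapT => xy0.
  have [[hD hN h0] hne] := hP [set j (x ⊖ y)]; apply: (hne _ xy0 erefl).
  rewrite /mv_sub hN hD hN; have /= -> := congr1 (@^~ [set j (x ⊖ y)]) xy.
  by rewrite mv_addNx mv_neg1.
exists (fun x Y => h Y x); split.
- by move=> x y; apply/funext => Y; have [[hD _ _] _] := hP Y; exact: hD.
- by move=> x; apply/funext => Y; have [[_ hN _] _] := hP Y; exact: hN.
- by apply/funext => Y; have [[_ _ h0] _] := hP Y; exact: h0.
- by move=> x y xy; apply: mv_le_anti; apply/mv_sub_eq0; exact: sub0.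
Qed.

End UltrapowerEmbedding.

Theorem theorem11 (R : realType) (alpha : Type)
    (alpha_inf : infinite_set [set: alpha]) :
  exists (U : set_system (finite_subset alpha)) (UU : UltraFilter U),
    regular_filter alpha U /\
    forall M : mvAlgType,
      mv_zero <> mv_one :> M ->
      [set: M] #<= [set: alpha] ->
      mv_embeds M
        (set alpha -> ultraproduct UU (fun=> unit_interval rat)) /\
      mv_embeds M
        (set alpha -> ultraproduct UU (fun=> unit_interval R)).
Proof.
have [U [UU fineU]] := fine_ultrafilter alpha; exists U, UU; split.
  exact: fine_filter_regular.
move=> M M01 /card_leP[j].
have j_inj : injective (fun x : M => val (j (SigSub (mem_setT x)))).
  by move=> x y /val_inj/inj/(congr1 val); apply; rewrite inE.
by split; exact: (ultrapower_embeds UU fineU _ j_inj M01).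
Qed.
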